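(* Let $\sigma$ be a relational signature. Let $U\subseteq\mathcal{M}(\mathrm{FO}(\sigma))$ be the image of the $\Gamma$-valued Stone pairing $A\mapsto\langle -,A\rangle_\Gamma$ on finite $\sigma$-structures, and $V\subseteq\mathcal{M}_I(\mathrm{FO}(\sigma))$ the image of the classical Stone pairing $A\mapsto\langle -,A\rangle_I$. Then $L_\gamma(\overline{U})=\overline{V}$, where the closures are taken in $\mathcal{M}(\mathrm{FO}(\sigma))$ and $\mathcal{M}_I(\mathrm{FO}(\sigma))$ respectively.
   Context: $\mathrm{FO}(\sigma)$ is the Lindenbaum–Tarski (Boolean) algebra of all first-order $\sigma$-formulas over variables $v_1,v_2,\dots$ modulo logical equivalence. $\Gamma$ is the set $\{r^-\mid r\in(0,1]\}\cup\{q^\circ\mid q\in\mathbb{Q}\cap[0,1]\}$, totally ordered by: $r^\circ<s^\circ$ iff $r<s$; $r^-<s^-$ iff $r<s$; $r^-<s^\circ$ iff $r\le s$; $s^\circ<r^-$ iff $s<r$; topologised by the subbasis $\{x\mid p^\circ\le x\}$ ($p\in\mathbb{Q}\cap[0,1]$), $\{x\mid x\le q^-\}$ ($q\in\mathbb{Q}\cap(0,1]$). Let $\mathrm{dom}=\{(x,y)\mid y\le x\}$; $\ominus$ on $\mathrm{dom}$: $r^\circ\ominus s^\circ=(r-s)^\circ$, $r^-\ominus s^\circ=(r-s)^-$, $r^\circ\ominus s^-=r^-\ominus s^-=(r-s)^\circ$ if $r-s\in\mathbb{Q}$ and $(r-s)^-$ otherwise; $x\oslash y=\bigvee\{x\ominus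 q^\circ\mid y<q^\circ\le x, q\in\mathbb{Q}\}$ (empty join $0^\circ$). For a bounded distributive lattice $D$, $\mathcal{M}(D)$ is the set of $\mu\colon D\to\Gamma$ with $\mu(0)=0^\circ$, $\mu(1)=1^\circ$, monotone, and $\mu(a)\oslash\mu(a\wedge b)\le\mu(a\vee b)\ominus\mu(b)$, $\mu(a)\ominus\mu(a\wedge b)\ge\mu(a\vee b)\oslash\mu(b)$ for all $a,b$, topologised as a subspace of $\Gamma^D$; $\mathcal{M}_I(D)$ is the set of finitely additive probability measures $m\colon D\to[0,1]$ (monotone, $m(0)=0$, $m(1)=1$, $m(a)+m(b)=m(a\vee b)+m(a\wedge b)$), topologised as a subspace of $[0,1]^D$. $L_\gamma(\mu)=\gamma\cdot\mu$ where $\gamma(r^-)=\gamma(r^\circ)=r$. Classical Stone pairing: $\langle\phi,A\rangle_I=|\{\bar a\in A^n\mid A\models\phi(\bar a)\}|/|A|^n$ for $\phi$ with free variables among $v_1,\dots,v_n$; $\Gamma$-valued Stone pairing: $\langle\phi,A\rangle_\Gamma=(\langle\phi,A\rangle_I)^\circ$ (a rational value, marked $\circ$). *)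

(* Defs.v *)
From HB Require Import structures.
From mathcomp Require Import all_boot all_order all_algebra.
From mathcomp Require Import all_classical all_reals all_analysis.

Set Implicit Arguments.
Unset Strict Implicit.
Unset Printing Implicit Defensive.

Import Order.TTheory GRing.Theory Num.Theory.
Import numFieldNormedType.Exports.

Local Open Scope classical_set_scope.
Local Open Scope ring_scope.
Local Open Scope quotient_scope.

(* The pair (r, false) encodes r^- and the pair (q, true) encodes q^o. *)
Definition Gamma_pred (R : realType) (p : R * bool) : bool :=
  if p.2 then (0 <= p.1 <= 1) && (p.1 \in @rational R) else 0 < p.1 <= 1.

Record Gamma (R : realType) :=
  MkGamma { Gamma_pair : R * bool; _ : Gamma_pred Gamma_pair }.

HB.instance Definition _ (R : realType) := [isSub for @Gamma_pair R].
HB.instance Definition _ (R : realType) := [Choice of Gamma R by <:].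

Definition gamma (R : realType) (x : Gamma R) : R := (Gamma_pair x).1.
Definition is_circ (R : realType) (x : Gamma R) : bool := (Gamma_pair x).2.

Lemma rational0 (R : realType) : @rational R 0.
Proof. by exists 0 => //; rewrite rmorph0. Qed.

Lemma rational1 (R : realType) : @rational R 1.
Proof. by exists 1 => //; rewrite rmorph1. Qed.

Lemma rationalB (R : realType) (x y : R) :
  rational x -> rational y -> rational (x - y).
Proof. by move=> [p _ <-] [q _ <-]; exists (p - q) => //; rewrite rmorphB. Qed.

Fact Gamma_zero_subproof (R : realType) : Gamma_pred ((0 : R), true).
Proof. by rewrite /Gamma_pred /= lexx ler01 /=; apply/mem_set/rational0. Qed.

Definition Gamma_zero (R : realType) : Gamma R :=
  MkGamma (Gamma_zero_subproof R).

(* Totalised constructors for q^o and r^-: they return 0^o when q (resp. r) is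
   not in the range required by Gamma. *)
Definition circ (R : realType) (q : R) : Gamma R :=
  insubd (Gamma_zero R) (q, true).
Definition minus (R : realType) (r : R) : Gamma R :=
  insubd (Gamma_zero R) (r, false).

Lemma gamma_inj (R : realType) (x y : Gamma R) :
  gamma x = gamma y -> is_circ x = is_circ y -> x = y.
Proof.
case: x y => [[r a] hx] [[s b] hy]; rewrite /gamma /is_circ /= => rs ab.
by apply: val_inj; rewrite /= rs ab.
Qed.

Lemma Gamma_circP (R : realType) (x : Gamma R) :
  is_circ x -> 0 <= gamma x <= 1 /\ rational (gamma x).
Proof.
case: x => [[r b] h]; rewrite /is_circ /gamma /= => bT; move: h.
by rewrite bT /Gamma_pred /= => /andP[-> /set_mem].
Qed.

Lemma Gamma_minusP (R : realType) (x : Gamma R) :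
  ~~ is_circ x -> 0 < gamma x <= 1.
Proof.
case: x => [[r b] h]; rewrite /is_circ /gamma /= => /negbTE bF.
by move: h; rewrite bF.
Qed.

Lemma gamma_ge0 (R : realType) (x : Gamma R) : 0 <= gamma x.
Proof.
have [/Gamma_circP[/andP[]]//|/Gamma_minusP/andP[/ltW]//] := boolP (is_circ x).
Qed.

Lemma gamma_le1 (R : realType) (x : Gamma R) : gamma x <= 1.
Proof.
have [/Gamma_circP[/andP[]]//|/Gamma_minusP/andP[]//] := boolP (is_circ x).
Qed.

Lemma Gamma_pair_insubd (R : realType) (p : R * bool) :
  Gamma_pair (insubd (Gamma_zero R) p) = if Gamma_pred p then p else (0, true).
Proof. exact: val_insubd. Qed.

Lemma Gamma_pair_circ (R : realType) (q : R) :
  0 <= q <= 1 -> rational q -> Gamma_pair (circ q) = (q, true).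
Proof.
move=> q01 ratq; rewrite /circ Gamma_pair_insubd.
by rewrite /Gamma_pred /= q01 (mem_set ratq).
Qed.

Lemma gamma_circ (R : realType) (q : R) :
  0 <= q <= 1 -> rational q -> gamma (circ q) = q.
Proof. by move=> q01 ratq; rewrite /gamma Gamma_pair_circ. Qed.

Lemma is_circ_circ (R : realType) (q : R) : is_circ (circ q).
Proof.
by rewrite /is_circ /circ Gamma_pair_insubd; case: ifP.
Qed.

Lemma Gamma_pair_minus (R : realType) (r : R) :
  0 < r <= 1 -> Gamma_pair (minus r) = (r, false).
Proof.
by move=> r01; rewrite /minus Gamma_pair_insubd /Gamma_pred /= r01.
Qed.

Lemma gamma_minus (R : realType) (r : R) : 0 < r <= 1 -> gamma (minus r) = r.
Proof. by move=> r01; rewrite /gamma Gamma_pair_minus. Qed.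

Lemma is_circ_minus (R : realType) (r : R) :
  0 < r <= 1 -> is_circ (minus r) = false.
Proof. by move=> r01; rewrite /is_circ Gamma_pair_minus. Qed.

Definition Gamma_lt (R : realType) (x y : Gamma R) : bool :=
  if ~~ is_circ x && is_circ y then gamma x <= gamma y else gamma x < gamma y.

Definition Gamma_le (R : realType) (x y : Gamma R) : bool :=
  (x == y) || Gamma_lt x y.

Fact Gamma_lt_irr (R : realType) : irreflexive (@Gamma_lt R).
Proof. by move=> x; rewrite /Gamma_lt andNb ltxx. Qed.

Fact Gamma_lt_trans (R : realType) : transitive (@Gamma_lt R).
Proof.
move=> y x z; rewrite /Gamma_lt.
case: (is_circ x); case: (is_circ y); case: (is_circ z) => /=;
  by [exact: lt_trans|exact: lt_le_trans|exact: le_lt_trans|exact: le_trans|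
      move=> h1 h2; apply: ltW; apply: lt_le_trans h1 h2|
      move=> h1 h2; apply: ltW; apply: le_lt_trans h1 h2|
      move=> h1 h2; apply: ltW; apply: lt_trans h1 h2].
Qed.

Fact Gamma_lt_total (R : realType) (x y : Gamma R) :
  x != y -> Gamma_lt x y || Gamma_lt y x.
Proof.
move=> xy; rewrite /Gamma_lt.
have [g|g|g] := ltgtP (gamma x) (gamma y).
- by rewrite ?if_same.
- by rewrite ?if_same orbT.
- case xc : (is_circ x); case yc : (is_circ y) => //=.
  + by case/eqP: xy; apply: gamma_inj; rewrite // xc.
  + by case/eqP: xy; apply: gamma_inj; rewrite // xc.
Qed.

Fact Gamma_display : Order.disp_t. Proof. exact: (Order.Disp tt tt). Qed.

HB.instance Definition _ (R : realType) := @Order.LtOrder.Build Gamma_display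
  (Gamma R) (@Gamma_le R) (@Gamma_lt R) _ _ (fun _ _ => erefl) (fun _ _ => erefl)
  (fun _ _ => erefl) (@Gamma_lt_irr R) (@Gamma_lt_trans R) (@Gamma_lt_total R).

Lemma Gamma_ltE (R : realType) (x y : Gamma R) : (x < y)%O =
  if ~~ is_circ x && is_circ y then gamma x <= gamma y else gamma x < gamma y.
Proof. by []. Qed.

Lemma Gamma_leE (R : realType) (x y : Gamma R) : (x <= y)%O =
  if is_circ x && ~~ is_circ y then gamma x < gamma y else gamma x <= gamma y.
Proof.
rewrite leNgt Gamma_ltE.
by case: (is_circ x); case: (is_circ y); rewrite /= -?ltNge -?leNgt.
Qed.

Lemma gamma_homo (R : realType) (x y : Gamma R) :
  (x <= y)%O -> gamma x <= gamma y.
Proof. by rewrite Gamma_leE; case: ifP => // _ /ltW. Qed.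

(* p^o ranges over the elements of Gamma marked with o, and q^-, for q rational,
   over the other elements of rational value. *)
Definition Gamma_subbasis (R : realType) : set (set (Gamma R)) :=
  [set B | (exists2 p : Gamma R, is_circ p & B = [set x | (p <= x)%O]) \/
    (exists2 q : Gamma R, ~~ is_circ q /\ rational (gamma q) &
       B = [set x | (x <= q)%O])].

HB.instance Definition _ (R : realType) :=
  @isSubBaseTopological.Build (Gamma R) (set (Gamma R)) (@Gamma_subbasis R) id.

(* Only meaningful on the domain {(x, y) | y <= x}, where the arguments of circ
   and minus below are always in range; see gamma_ominus and is_circ_ominus. *)
Definition ominus (R : realType) (x y : Gamma R) : Gamma R :=
  let d := gamma x - gamma y in
  if is_circ y then (if is_circ x then circ d else minus d)
  else if d \in @rational R then circ d else minus d.

Definition oslash (R : realType) (x y : Gamma R) : Gamma R :=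
  supremum (Gamma_zero R)
    [set ominus x q | q in [set q | [/\ is_circ q, (y < q)%O & (q <= x)%O]]].

Lemma ominus_in_range (R : realType) (x y : Gamma R) :
  (y <= x)%O -> let d := gamma x - gamma y in
  [/\ 0 <= d <= 1,
      is_circ x -> is_circ y -> rational d,
      ~~ is_circ x -> is_circ y -> 0 < d &
      ~ rational d -> 0 < d].
Proof.
move=> yx d; have d01 : 0 <= d <= 1.
  rewrite subr_ge0 gamma_homo //= lerBlDr.
  by apply: le_trans (gamma_le1 x) _; rewrite lerDl gamma_ge0.
split => //.
- by move=> /Gamma_circP[_ rx] /Gamma_circP[_ ry]; apply: rationalB.
- by move: yx; rewrite Gamma_leE subr_gt0 => + xm yc; rewrite yc xm.
- move=> dr; have /andP[d0 _] := d01; rewrite lt_neqAle d0 andbT.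
  by apply/eqP => dE; apply: dr; rewrite -dE; apply: rational0.
Qed.

Lemma gamma_ominus (R : realType) (x y : Gamma R) :
  (y <= x)%O -> gamma (ominus x y) = gamma x - gamma y.
Proof.
move=> /ominus_in_range[d01 h1 h2 h3]; have /andP[_ d1] := d01; rewrite /ominus.
have [yc|yc] := boolP (is_circ y).
  have [xc|xc] := boolP (is_circ x).
    by rewrite gamma_circ //; apply: h1.
  by rewrite gamma_minus // h2.
case: ifPn => [/set_mem dr|/negP dr].
  by rewrite gamma_circ.
by rewrite gamma_minus // h3 //= => ?; apply: dr; apply: mem_set.
Qed.

Lemma is_circ_ominus (R : realType) (x y : Gamma R) : (y <= x)%O ->
  is_circ (ominus x y) =
    if is_circ y then is_circ x else gamma x - gamma y \in @rational R.
Proof.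
move=> /ominus_in_range[d01 h1 h2 h3]; have /andP[_ d1] := d01; rewrite /ominus.
have [yc|yc] := boolP (is_circ y).
  have [xc|xc] := boolP (is_circ x); first by rewrite is_circ_circ.
  by rewrite is_circ_minus // h2.
case: ifPn => [/set_mem dr|/negP dr]; first by rewrite is_circ_circ.
by rewrite is_circ_minus // h3 //= => ?; apply: dr; apply: mem_set.
Qed.

Lemma rational_between (R : realType) (a b : R) :
  a < b -> exists2 q, rational q & a < q < b.
Proof.
move=> /rat_in_itvoo[q]; rewrite in_itv /= => aqb.
by exists (ratr q) => //; exists q.
Qed.

Lemma circ_between (R : realType) (x y : Gamma R) (a b : R) :
  gamma y <= a -> a < b -> b <= gamma x ->
  exists q : Gamma R, [/\ is_circ q, (y < q)%O, (q <= x)%O & a < gamma q < b].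
Proof.
move=> ya /rational_between[q ratq /andP[aq qb]] bx.
have q01 : 0 <= q <= 1.
  rewrite (le_trans (gamma_ge0 y)) ?(le_trans ya) ?(ltW aq) //=.
  by rewrite (le_trans (ltW qb)) // (le_trans bx) // gamma_le1.
have yq : gamma y < q by apply: le_lt_trans aq.
have qx : q < gamma x by apply: lt_le_trans bx.
exists (circ q); split; first exact: is_circ_circ.
- by rewrite Gamma_ltE gamma_circ //; case: ifP => // _; apply: ltW.
- by rewrite Gamma_leE gamma_circ //; case: ifP => // _; apply: ltW.
- by rewrite gamma_circ // aq.
Qed.

(* The proof exhibits the join defining oslash when its index set is nonempty:
   the default value of supremum is only used for the empty join. *)
Lemma gamma_oslash (R : realType) (x y : Gamma R) :
  (y <= x)%O -> gamma (oslash x y) = gamma x - gamma y.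
Proof.
move=> yx; rewrite /oslash.
set Q := (X in [set _ | _ in X]); set A := (X in supremum _ X).
have Qle q : Q q -> (q <= x)%O by case.
have [A0|/set0P[z0 Az0]] := eqVneq A set0.
  rewrite A0 supremum0; apply/esym/eqP.
  rewrite subr_eq0 eq_le [X in _ && X]gamma_homo // andbT.
  rewrite leNgt; apply/negP => xy.
  have [q [q1 q2 q3 _]] := circ_between (lexx _) xy (lexx _).
  have : A (ominus x q) by exists q.
  by rewrite A0.
suff [z Az gz] : exists2 z, supremums A z & gamma z = gamma x - gamma y.
  rewrite /supremum; case: ifP => [/eqP A0|_]; first by move: Az0; rewrite A0.
  case: xgetP => [w _ Aw|/(_ z)/(_ Az)//].
  by rewrite (is_subset1_supremums Aw Az).
have least u : ubound A u -> gamma x - gamma y <= gamma u.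
  move=> Au; rewrite leNgt; apply/negP => ud.
  have h1 : gamma y < gamma x - gamma u by rewrite ltrBrDr addrC -ltrBrDr.
  have h2 : gamma x - gamma u <= gamma x by rewrite gerBl gamma_ge0.
  have [q [q1 q2 q3 /andP[_ qu]]] := circ_between (lexx _) h1 h2.
  have /Au/gamma_homo : A (ominus x q) by exists q.
  by rewrite gamma_ominus // leNgt; apply/negP; rewrite negbK ltrBrDr addrC -ltrBrDr.
case: (pselect (exists2 q, Q q & gamma q = gamma y)) => [[q Qq qy]|nQ].
  exists (ominus x q); last by rewrite gamma_ominus ?qy //; apply: Qle.
  split; last by move=> u; apply; exists q.
  move=> _ [p Qp <-]; rewrite Gamma_leE.
  rewrite !gamma_ominus ?Qle // !is_circ_ominus ?Qle //.
  have [qc _ _] := Qq; have [pc yp _] := Qp; rewrite qc pc andbN qy lerB //.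
  by apply: gamma_homo; apply: ltW.
have [q Qq _] := Az0; have [qc yq qx] := Qq.
have Qlt p : Q p -> gamma y < gamma p.
  move=> Qp; have [_ /ltW/gamma_homo yp _] := Qp.
  rewrite lt_neqAle yp andbT; apply/eqP => E; apply: nQ; exists p => //.
have [d01 _ _ _] := ominus_in_range yx; have /andP[_ d1] := d01.
have d0 : 0 < gamma x - gamma y.
  by rewrite subr_gt0 (lt_le_trans (Qlt _ Qq)) // gamma_homo.
have dm : 0 < gamma x - gamma y <= 1 by rewrite d0.
exists (minus (gamma x - gamma y)); last exact: gamma_minus.
split.
  move=> _ [p Qp <-]; rewrite Gamma_leE gamma_minus // gamma_ominus ?Qle //.
  have h : gamma x - gamma p < gamma x - gamma y by rewrite ltrD2l ltrN2 Qlt.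
  by case: ifP => // _; apply: ltW.
by move=> u /least du; rewrite Gamma_leE gamma_minus // is_circ_minus.
Qed.

Definition Gamma_measure (R : realType) (d : Order.disp_t)
    (D : tbDistrLatticeType d) : set {ptws D -> Gamma R} :=
  [set mu | [/\ mu \bot%O = circ 0, mu \top%O = circ 1,
      (forall a b : D, (a <= b)%O -> (mu a <= mu b)%O),
      (forall a b : D, (oslash (mu a) (mu (a `&` b)%O)
         <= ominus (mu (a `|` b)%O) (mu b))%O) &
      (forall a b : D, (ominus (mu a) (mu (a `&` b)%O)
         >= oslash (mu (a `|` b)%O) (mu b))%O)]].

(* The [0, 1]-valued functions are taken among the R-valued ones: [0, 1]^D is
   a subspace of R^D. *)
Definition I_measure (R : realType) (d : Order.disp_t)
    (D : tbDistrLatticeType d) : set {ptws D -> R} :=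
  [set m | [/\ (forall a : D, 0 <= m a <= 1), m \bot%O = 0, m \top%O = 1,
      (forall a b : D, (a <= b)%O -> m a <= m b) &
      (forall a b : D, m a + m b = m (a `|` b)%O + m (a `&` b)%O)]].

Arguments Gamma_measure : clear implicits.
Arguments Gamma_measure R {d} D.
Arguments I_measure : clear implicits.
Arguments I_measure R {d} D.

(* M(D) and M_I(D) with the subspace topology, which set_type carries. *)
Definition M (R : realType) (d : Order.disp_t) (D : tbDistrLatticeType d) :
  topologicalType := set_type (Gamma_measure R D).
Definition M_I (R : realType) (d : Order.disp_t) (D : tbDistrLatticeType d) :
  topologicalType := set_type (I_measure R D).

Arguments M R {d} D.
Arguments M_I R {d} D.

Lemma L_gamma_subproof (R : realType) (d : Order.disp_t)
    (D : tbDistrLatticeType d) (mu : M R D) :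
  I_measure R D (fun a => gamma (set_val mu a)).
Proof.
have := set_valP mu; rewrite -[val mu]/(set_val mu).
move: (set_val mu) => {}mu [mu0 mu1 mono h1 h2]; split.
- by move=> a; rewrite gamma_ge0 gamma_le1.
- by rewrite mu0 gamma_circ ?lexx ?ler01 //; apply: rational0.
- by rewrite mu1 gamma_circ ?lexx ?ler01 //; apply: rational1.
- by move=> a b /mono/gamma_homo.
- move=> a b; have mI : (mu (a `&` b)%O <= mu a)%O by apply/mono/leIl.
  have mU : (mu b <= mu (a `|` b)%O)%O by apply/mono/leUr.
  have := gamma_homo (h1 a b); have := gamma_homo (h2 a b).
  rewrite !gamma_oslash // !gamma_ominus // => e1 e2.
  have /eqP : gamma (mu a) - gamma (mu (a `&` b)%O) =
         gamma (mu (a `|` b)%O) - gamma (mu b).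
    by apply/eqP; rewrite eq_le e1 e2.
  by rewrite subr_eq addrAC eq_sym subr_eq => /eqP.
Qed.

Definition L_gamma (R : realType) (d : Order.disp_t)
    (D : tbDistrLatticeType d) (mu : M R D) : M_I R D :=
  SigSub (mem_set (L_gamma_subproof mu)).

Record signature := Signature { symbol : Type; arity : symbol -> nat }.

(* The variable v_(i + 1) is represented by the natural number i. *)
Inductive formula (S : signature) : Type :=
| FEq of nat & nat
| FRel (p : symbol S) of (arity p).-tuple nat
| FBot
| FTop
| FNot of formula S
| FAnd of formula S & formula S
| FOr of formula S & formula S
| FImp of formula S & formula S
| FEx of nat & formula S
| FAll of nat & formula S.

Arguments FEq {S}.
Arguments FBot {S}.
Arguments FTop {S}.

Record structure (S : signature) := Structure {
  carrier :> Type;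
  interp : forall p : symbol S, (arity p).-tuple carrier -> Prop }.

Definition update (A : Type) (v : nat -> A) (i : nat) (a : A) : nat -> A :=
  fun j => if j == i then a else v j.

Fixpoint sat (S : signature) (A : structure S) (v : nat -> A) (phi : formula S) :
    Prop :=
  match phi with
  | FEq i j => v i = v j
  | FRel p xs => @interp S A p (map_tuple v xs)
  | FBot => False
  | FTop => True
  | FNot phi => ~ sat v phi
  | FAnd phi psi => sat v phi /\ sat v psi
  | FOr phi psi => sat v phi \/ sat v psi
  | FImp phi psi => sat v phi -> sat v psi
  | FEx i phi => exists a, sat (update v i a) phi
  | FAll i phi => forall a, sat (update v i a) phi
  end.

Fixpoint free_vars (S : signature) (phi : formula S) : seq nat :=
  match phi with
  | FEq i j => [:: i; j]
  | FRel p xs => xs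
  | FBot | FTop => [::]
  | FNot phi => free_vars phi
  | FAnd phi psi | FOr phi psi | FImp phi psi => free_vars phi ++ free_vars psi
  | FEx i phi | FAll i phi => [seq j <- free_vars phi | j != i]
  end.

(* Entailment and equivalence over all structures with all assignments. A
   structure with empty carrier has no assignment, so the quantification is
   effectively over nonempty structures. *)
Definition entails (S : signature) (phi psi : formula S) : Prop :=
  forall (A : structure S) (v : nat -> A), sat v phi -> sat v psi.

Definition log_equiv (S : signature) (phi psi : formula S) : bool :=
  `[< forall (A : structure S) (v : nat -> A), sat v phi <-> sat v psi >].

HB.instance Definition _ (S : signature) := gen_eqMixin (formula S).
HB.instance Definition _ (S : signature) := gen_choiceMixin (formula S).

Fact log_equiv_refl (S : signature) : reflexive (@log_equiv S).
Proof. by move=> phi; apply/asboolP. Qed.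

Fact log_equiv_sym (S : signature) : symmetric (@log_equiv S).
Proof.
by move=> phi psi; apply/asboolP/asboolP => h A v; split => /h.
Qed.

Fact log_equiv_trans (S : signature) : transitive (@log_equiv S).
Proof.
move=> psi phi chi /asboolP h1 /asboolP h2; apply/asboolP => A v.
by rewrite h1 h2.
Qed.

Canonical log_equiv_equiv (S : signature) :=
  EquivRel (@log_equiv S) (@log_equiv_refl S) (@log_equiv_sym S)
    (@log_equiv_trans S).

Definition FO (S : signature) := {eq_quot (@log_equiv S)}.

HB.instance Definition _ (S : signature) := Choice.on (FO S).
HB.instance Definition _ (S : signature) := EqQuotient.on (FO S).

Lemma sat_repr (S : signature) (phi : formula S) (A : structure S) (v : nat -> A) :
  sat v (repr (\pi_(FO S) phi)) <-> sat v phi.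
Proof.
have /eqmodP/asboolP h : repr (\pi_(FO S) phi) = phi %[mod FO S].
  by rewrite reprK.
exact: h.
Qed.

Lemma FO_eqP (S : signature) (c e : FO S) :
  (forall (A : structure S) (v : nat -> A), sat v (repr c) <-> sat v (repr e)) ->
  c = e.
Proof. by move=> h; rewrite -[c]reprK -[e]reprK; apply/eqmodP/asboolP. Qed.

Definition FO_le (S : signature) (c e : FO S) : bool :=
  `[< entails (repr c) (repr e) >].
Definition FO_meet (S : signature) (c e : FO S) : FO S :=
  \pi_(FO S) (FAnd (repr c) (repr e)).
Definition FO_join (S : signature) (c e : FO S) : FO S :=
  \pi_(FO S) (FOr (repr c) (repr e)).
Definition FO_compl (S : signature) (c : FO S) : FO S := \pi_(FO S) (FNot (repr c)).
Definition FO_bot (S : signature) : FO S := \pi_(FO S) FBot.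
Definition FO_top (S : signature) : FO S := \pi_(FO S) FTop.

Fact FO_le_refl (S : signature) : reflexive (@FO_le S).
Proof. by move=> c; apply/asboolP => A v. Qed.

Fact FO_le_anti (S : signature) : antisymmetric (@FO_le S).
Proof.
move=> c e /andP[/asboolP h1 /asboolP h2]; apply: FO_eqP => A v.
by split; [apply: h1|apply: h2].
Qed.

Fact FO_le_trans (S : signature) : transitive (@FO_le S).
Proof.
by move=> c b e /asboolP h1 /asboolP h2; apply/asboolP => A v /h1 /h2.
Qed.

Fact FO_display : Order.disp_t. Proof. exact: (Order.Disp tt tt). Qed.

HB.instance Definition _ (S : signature) := @Order.Le_isPOrder.Build FO_display
  (FO S) (@FO_le S) (@FO_le_refl S) (@FO_le_anti S) (@FO_le_trans S).

Fact FO_meetP (S : signature) (x y z : FO S) :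
  (x <= FO_meet y z)%O = (x <= y)%O && (x <= z)%O.
Proof.
apply/asboolP/andP => [h|[/asboolP h1 /asboolP h2] A v xv].
  by split; apply/asboolP => A v /h /sat_repr[].
by apply/sat_repr; split; [apply: h1|apply: h2].
Qed.

Fact FO_joinP (S : signature) (x y z : FO S) :
  (FO_join x y <= z)%O = (x <= z)%O && (y <= z)%O.
Proof.
apply/asboolP/andP => [h|[/asboolP h1 /asboolP h2] A v /sat_repr[/h1|/h2]//].
by split; apply/asboolP => A v xv; apply: h; apply/sat_repr; [left|right].
Qed.

HB.instance Definition _ (S : signature) :=
  @Order.POrder_MeetJoin_isLattice.Build FO_display (FO S)
    (@FO_meet S) (@FO_join S) (@FO_meetP S) (@FO_joinP S).

Lemma sat_meet (S : signature) (x y : FO S) (A : structure S) (v : nat -> A) :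
  sat v (repr (x `&` y)%O) <-> sat v (repr x) /\ sat v (repr y).
Proof. exact: sat_repr. Qed.

Lemma sat_join (S : signature) (x y : FO S) (A : structure S) (v : nat -> A) :
  sat v (repr (x `|` y)%O) <-> sat v (repr x) \/ sat v (repr y).
Proof. exact: sat_repr. Qed.

Fact FO_meetUl (S : signature) :
  left_distributive (@Order.meet _ (FO S)) (@Order.join _ (FO S)).
Proof.
move=> x y z; apply: FO_eqP => A v.
by rewrite sat_join !sat_meet sat_join; tauto.
Qed.

HB.instance Definition _ (S : signature) :=
  @Order.Lattice_Meet_isDistrLattice.Build FO_display (FO S) (@FO_meetUl S).

Fact FO_le0x (S : signature) (x : FO S) : (FO_bot S <= x)%O.
Proof. by apply/asboolP => A v /sat_repr. Qed.

Fact FO_lex1 (S : signature) (x : FO S) : (x <= FO_top S)%O.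
Proof. by apply/asboolP => A v _; apply/sat_repr. Qed.

HB.instance Definition _ (S : signature) :=
  @Order.hasBottom.Build FO_display (FO S) (FO_bot S) (@FO_le0x S).
HB.instance Definition _ (S : signature) :=
  @Order.hasTop.Build FO_display (FO S) (FO_top S) (@FO_lex1 S).

Fact FO_joinxC (S : signature) (x : FO S) : (x `|` FO_compl x = \top)%O.
Proof.
apply: FO_eqP => A v; rewrite sat_join !sat_repr /=; split=> // _.
exact: EM.
Qed.

Fact FO_meetxC (S : signature) (x : FO S) : (x `&` FO_compl x = \bot)%O.
Proof.
by apply: FO_eqP => A v; rewrite sat_meet !sat_repr /=; tauto.
Qed.

HB.instance Definition _ (S : signature) :=
  @Order.TBDistrLattice_hasComplement.Build FO_display (FO S)
    (@FO_compl S) (@FO_joinxC S) (@FO_meetxC S).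

Record fin_structure (S : signature) := FinStructure {
  fin_carrier : finType;
  fin_interp : forall p : symbol S, (arity p).-tuple fin_carrier -> Prop;
  fin_nonempty : (0 < #|fin_carrier|)%N }.

Definition structure_of_fin (S : signature) (A : fin_structure S) : structure S :=
  @Structure S (fin_carrier A) (@fin_interp S A).
Coercion structure_of_fin : fin_structure >-> structure.

(* A |= phi(a_1, ..., a_n): phi holds under the assignments v_i |-> a_i, whatever
   the values of the other variables. *)
Definition tuple_sat (S : signature) (A : structure S) (n : nat)
    (phi : formula S) (t : n.-tuple A) : Prop :=
  forall v : nat -> A, (forall i : 'I_n, v i = tnth t i) -> sat v phi.

Definition stone_ratio (R : realType) (S : signature) (n : nat)
    (phi : formula S) (A : fin_structure S) : R :=
  #|[set t : n.-tuple (fin_carrier A) | `[< @tuple_sat S A n phi t >]]%SET|%:R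
  / (#|fin_carrier A| ^ n)%:R.

(* The least n such that all free variables of phi are among the first n ones;
   see stone_pairE for the independence of the choice of n and phi. *)
Definition num_vars (S : signature) (phi : formula S) : nat :=
  \max_(i <- free_vars phi) i.+1.

Definition stone_pair (R : realType) (S : signature) (A : fin_structure S)
    (c : FO S) : R :=
  stone_ratio R (num_vars (repr c)) (repr c) A.

Lemma sat_coincidence (S : signature) (A : structure S) (phi : formula S)
    (v w : nat -> A) :
  {in free_vars phi, v =1 w} -> sat v phi <-> sat w phi.
Proof.
elim: phi v w => /=.
- by move=> i j v w vw; rewrite !vw // !inE eqxx ?orbT.
- move=> p xs v w vw; suff -> : map_tuple v xs = map_tuple w xs by [].
  by apply: val_inj; apply/eq_in_map.
- by [].
- by [].
- by move=> phi IH v w /IH ->.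
- move=> phi IH psi IH' v w vw.
  by rewrite (IH v w) ?(IH' v w) // => i hi; apply: vw; rewrite mem_cat hi ?orbT.
- move=> phi IH psi IH' v w vw.
  by rewrite (IH v w) ?(IH' v w) // => i hi; apply: vw; rewrite mem_cat hi ?orbT.
- move=> phi IH psi IH' v w vw.
  by rewrite (IH v w) ?(IH' v w) // => i hi; apply: vw; rewrite mem_cat hi ?orbT.
- move=> i phi IH v w vw.
  have h a : sat (update v i a) phi <-> sat (update w i a) phi.
    apply: IH => j hj; rewrite /update; case: eqP => // /eqP ji.
    by apply: vw; rewrite mem_filter ji.
  by split=> -[a /h ha]; exists a.
- move=> i phi IH v w vw.
  have h a : sat (update v i a) phi <-> sat (update w i a) phi.
    apply: IH => j hj; rewrite /update; case: eqP => // /eqP ji.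
    by apply: vw; rewrite mem_filter ji.
  by split=> ha a; apply/h.
Qed.

Lemma lt_num_vars (S : signature) (phi : formula S) (i : nat) :
  i \in free_vars phi -> (i < num_vars phi)%N.
Proof. by move=> hi; apply: (leq_bigmax_seq (F := succn)). Qed.

Lemma tuple_satE (S : signature) (A : structure S) (phi : formula S) (n : nat)
    (t : n.-tuple A) (v : nat -> A) :
  (num_vars phi <= n)%N -> (forall i : 'I_n, v i = tnth t i) ->
  tuple_sat phi t <-> sat v phi.
Proof.
move=> hn vt; split=> [|hv w wt]; first exact.
apply: (proj1 (@sat_coincidence S A phi v w _)) hv => i /lt_num_vars hi.
have ii : (i < n)%N by apply: leq_trans hn.
by rewrite (vt (Ordinal ii)) (wt (Ordinal ii)).
Qed.

Lemma fin_point (S : signature) (A : fin_structure S) : fin_carrier A.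
Proof. by have /card_gt0P/cid[] := fin_nonempty A. Qed.

Lemma tuple_sat_nth (S : signature) (A : fin_structure S) (phi : formula S)
    (n : nat) (t : n.-tuple A) : (num_vars phi <= n)%N ->
  tuple_sat phi t <-> @sat S A (nth (fin_point A) t) phi.
Proof. by move=> hn; apply: tuple_satE => // i; rewrite -tnth_nth. Qed.

Lemma stone_ratioS (R : realType) (S : signature) (n : nat) (phi : formula S)
    (A : fin_structure S) : (num_vars phi <= n)%N ->
  stone_ratio R n.+1 phi A = stone_ratio R n phi A.
Proof.
move=> hn; rewrite /stone_ratio.
set X := (X in #|pred_of_set X|%:R / (_ ^ n.+1)%:R).
set Y := (X in _ = #|pred_of_set X|%:R / _).
have -> : X =
    [set rcons_tuple p.2 p.1 | p in finset.setX [set: fin_carrier A]%SET Y]%SET.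
  apply/setP => t; apply/idP/imsetP => [|[[a s]]].
  - rewrite finset.in_set => /asboolP /(tuple_sat_nth _ (leqW hn)) ht.
    have ht0 : size (take n t) == n by rewrite size_takel // size_tuple.
    exists (nth (fin_point A) t n, Tuple ht0); last first.
      apply: val_inj; rewrite /= -take_nth ?size_tuple //.
      by rewrite take_oversize // size_tuple.
    rewrite finset.in_setX finset.in_setT finset.in_set /=.
    apply/asboolP; apply: (proj2 (tuple_sat_nth _ hn)).
    apply: (proj1 (@sat_coincidence S A phi _ _ _)) ht => i /lt_num_vars hi /=.
    by rewrite nth_take // (leq_trans hi).
  - rewrite finset.in_setX finset.in_setT finset.in_set /= => /asboolP.
    move=> /(tuple_sat_nth _ hn) hs ->; rewrite finset.in_set.
    apply/asboolP; apply: (proj2 (tuple_sat_nth _ (leqW hn))).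
    apply: (proj1 (@sat_coincidence S A phi _ _ _)) hs => i /lt_num_vars hi /=.
    by rewrite nth_rcons size_tuple (leq_trans hi hn).
rewrite card_imset; last first.
  by move=> [a s] [b u] /(congr1 val)/rcons_inj[/val_inj -> ->].
rewrite cardsX cardsT expnS !natrM invfM mulrACA divff ?mul1r //.
by rewrite pnatr_eq0 -lt0n fin_nonempty.
Qed.

Lemma stone_ratio_indep (R : realType) (S : signature) (n : nat) (phi : formula S)
    (A : fin_structure S) : (num_vars phi <= n)%N ->
  stone_ratio R n phi A = stone_ratio R (num_vars phi) phi A.
Proof.
elim: n => [|n IH]; first by rewrite leqn0 => /eqP ->.
rewrite leq_eqVlt => /orP[/eqP -> //|]; rewrite ltnS => hn.
by rewrite stone_ratioS // IH.
Qed.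

Lemma stone_pairE (R : realType) (S : signature) (A : fin_structure S)
    (phi : formula S) (n : nat) : {in free_vars phi, forall i, (i < n)%N} ->
  stone_pair R A (\pi_(FO S) phi) = stone_ratio R n phi A.
Proof.
move=> hn; have {}hn : (num_vars phi <= n)%N by apply/bigmax_leqP_seq => i /hn.
rewrite /stone_pair; set psi := repr _.
pose N := maxn n (num_vars psi).
rewrite -(stone_ratio_indep R A (leq_maxr n _)) -/N.
rewrite (stone_ratio_indep R A hn).
rewrite -(stone_ratio_indep R A (leq_trans hn (leq_maxl n (num_vars psi)))).
rewrite -/N /stone_ratio; congr (_%:R / _).
apply: eq_card => t; rewrite !finset.in_set.
by apply/asboolP/asboolP => h v /h /sat_repr.
Qed.

Lemma stone_pair_ratio (R : realType) (S : signature) (A : fin_structure S)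
    (c : FO S) (n : nat) : (num_vars (repr c) <= n)%N ->
  stone_pair R A c = stone_ratio R n (repr c) A.
Proof. by move=> hn; rewrite (stone_ratio_indep R A hn). Qed.

Lemma stone_pair_measure (R : realType) (S : signature) (A : fin_structure S) :
  I_measure R (FO S) (stone_pair R A).
Proof.
pose X n (c : FO S) :=
  [set t : n.-tuple (fin_carrier A) | `[< @tuple_sat S A n (repr c) t >]]%SET.
have XE n c t : (num_vars (repr c) <= n)%N ->
    t \in X n c <-> @sat S A (nth (fin_point A) t) (repr c).
  move=> hn; rewrite finset.in_set; split=> [/asboolP/tuple_sat_nth|]; first exact.
  by move=> /(tuple_sat_nth _ hn) ?; apply/asboolP.
have cardT n : #|[set: n.-tuple (fin_carrier A)]%SET| = (#|fin_carrier A| ^ n)%N.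
  by rewrite cardsT card_tuple.
have A0 n : 0 < (#|fin_carrier A| ^ n)%:R :> R.
  by rewrite ltr0n expn_gt0 fin_nonempty.
split.
- move=> c; rewrite /stone_pair /stone_ratio divr_ge0 //= ler_pdivrMr // mul1r.
  by rewrite ler_nat -cardT; apply: subset_leq_card; rewrite finset.subsetT.
- rewrite /stone_pair /stone_ratio -/(X _ _); apply/eqP; rewrite mulf_eq0.
  rewrite pnatr_eq0 cards_eq0; apply/orP; left; apply/eqP/setP => t.
  by rewrite finset.in_set0; apply/negP => /XE-/(_ (leqnn _))/sat_repr.
- rewrite /stone_pair /stone_ratio -/(X _ _) -cardT.
  have -> : X (num_vars (repr (\top%O : FO S))) \top%O = [set: _]%SET.
    by apply/setP => t; rewrite finset.in_setT; apply/XE => //; apply/sat_repr.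
  by rewrite divff // cardT gt_eqF.
- move=> a b ab; pose n := maxn (num_vars (repr a)) (num_vars (repr b)).
  rewrite !(@stone_pair_ratio _ _ _ _ n) ?leq_maxl ?leq_maxr //.
  rewrite /stone_ratio -/(X n a) -/(X n b) ler_pM2r ?invr_gt0 // ler_nat.
  apply/subset_leq_card/fintype.subsetP => t /XE; rewrite leq_maxl => /(_ isT) ha.
  by apply/XE; rewrite ?leq_maxr //; move/asboolP: ab; apply.
- move=> a b.
  pose n := maxn (maxn (num_vars (repr a)) (num_vars (repr b)))
    (maxn (num_vars (repr (a `|` b)%O)) (num_vars (repr (a `&` b)%O))).
  have ha : (num_vars (repr a) <= n)%N by rewrite !leq_max leqnn.
  have hb : (num_vars (repr b) <= n)%N by rewrite !leq_max leqnn orbT.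
  have hU : (num_vars (repr (a `|` b)%O) <= n)%N.
    by rewrite !leq_max leqnn !orbT.
  have hI : (num_vars (repr (a `&` b)%O) <= n)%N.
    by rewrite !leq_max leqnn !orbT.
  rewrite !(@stone_pair_ratio _ _ _ _ n) //.
  rewrite /stone_ratio -!mulrDl -!natrD; congr (_%:R / _).
  rewrite -!/(X n _).
  have -> : X n (a `|` b)%O = (X n a :|: X n b)%SET.
    apply/setP => t; rewrite finset.in_setU; apply/idP/orP.
      by move=> /XE-/(_ hU)/sat_join[] h; [left|right]; apply/XE.
    by case=> /XE h; apply/XE => //; apply/sat_join; [left|right]; apply: h.
  have -> : X n (a `&` b)%O = (X n a :&: X n b)%SET.
    apply/setP => t; rewrite finset.in_setI; apply/idP/andP.
      by move=> /XE-/(_ hI)/sat_meet[] h1 h2; split; apply/XE.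
    move=> [/XE-/(_ ha) h1 /XE-/(_ hb) h2].
    by apply/XE => //; apply/sat_meet.
  by rewrite cardsUI.
Qed.

Definition stone_pairing_I (R : realType) (S : signature) (A : fin_structure S) :
    M_I R (FO S) :=
  SigSub (mem_set (stone_pair_measure R A)).

Lemma stone_pair_rational (R : realType) (S : signature) (A : fin_structure S)
    (c : FO S) : rational (stone_pair R A c).
Proof.
rewrite /stone_pair /stone_ratio; set k := #|_|; set l := (_ ^ _)%N.
by exists (k%:R / l%:R) => //; rewrite fmorph_div /= !ratr_nat.
Qed.

Lemma Gamma_stone_pair_measure (R : realType) (S : signature)
    (A : fin_structure S) :
  Gamma_measure R (FO S) (fun c => circ (stone_pair R A c)).
Proof.
have [p01 p0 p1 pmono padd] := stone_pair_measure R A.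
have pE c : gamma (circ (stone_pair R A c)) = stone_pair R A c.
  by apply: gamma_circ; [exact: p01|exact: stone_pair_rational].
pose mu (c : FO S) := circ (stone_pair R A c).
have mono (a b : FO S) : (a <= b)%O -> (mu a <= mu b)%O.
  by move=> ab; rewrite Gamma_leE !is_circ_circ /= !pE pmono.
have mI (a b : FO S) : (mu (a `&` b) <= mu a)%O by apply/mono/leIl.
have mU (a b : FO S) : (mu b <= mu (a `|` b))%O by apply/mono/leUr.
have add (a b : FO S) : stone_pair R A a - stone_pair R A (a `&` b)%O =
    stone_pair R A (a `|` b)%O - stone_pair R A b.
  by apply/eqP; rewrite subr_eq addrAC eq_sym subr_eq eq_sym padd.
split; rewrite ?p0 ?p1 //.
- move=> a b; rewrite Gamma_leE gamma_oslash ?mI // gamma_ominus ?mU //.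
  by rewrite is_circ_ominus ?mU // !is_circ_circ andbF !pE add.
- move=> a b; rewrite Gamma_leE gamma_oslash ?mU // gamma_ominus ?mI //.
  by rewrite is_circ_ominus ?mI // !is_circ_circ andbF !pE add.
Qed.

Definition stone_pairing_Gamma (R : realType) (S : signature)
    (A : fin_structure S) : M R (FO S) :=
  SigSub (mem_set (Gamma_stone_pair_measure R A)).

(* Main.v *)
(* An element x of Gamma is determined by the set of rationals p with p^o <= x,
   and the sets {x | p^o <= x} and their complements generate the topology. So
   an ultrafilter on Gamma converges to the element whose cut it selects: Gamma
   is compact. In terms of cuts, q^o <= ominus x y says that p^o <= y implies
   (p + q)^o <= x, and q^o <= oslash x y (for q > 0) says that some p^o with
   y < p^o has (p + q)^o <= x. Hence each axiom of a Gamma-valued measure is a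
   conjunction of clopen conditions, M(D) is closed in Gamma^D and so compact,
   and the continuous map L_gamma into the Hausdorff space M_I(D) commutes with
   closures. It maps the one Stone pairing to the other. *)

Require Import Defs.
From mathcomp Require Import all_boot all_order all_algebra.
From mathcomp Require Import all_classical all_reals all_analysis.
From mathcomp Require Import lra.

Set Implicit Arguments.
Unset Strict Implicit.
Unset Printing Implicit Defensive.

Import Order.TTheory GRing.Theory Num.Theory.
Import numFieldNormedType.Exports.

Local Open Scope ring_scope.
Local Open Scope classical_set_scope.

Lemma cvg_subbase (T : topologicalType) (B : set (set T)) (F : set_system T)
    (x : T) :
  Filter F ->
  open = [set \bigcup_(C in D) C | D in subset^~ (finI_from B id)] ->
  F --> x <-> forall C, B C -> C x -> F C.
Proof.
move=> FF openB; split=> [Fx C BC Cx|Fx A].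
  apply: Fx; apply: open_nbhs_nbhs; split=> //; rewrite openB.
  by exists [set C]; [move=> _ ->; exact: finI_from1|rewrite bigcup_set1].
rewrite nbhsE /open_nbhs/= openB => -[_ [[D DB <-] [C DC Cx]] DA].
apply: filterS DA _; apply: (@filterS _ _ _ C) => [y Cy|]; first by exists C.
have [E EB CE] := DB _ DC; rewrite -CE; apply: filter_bigI => A' EA'.
by apply: Fx; [exact/set_mem/EB|move: Cx; rewrite -CE; exact].
Qed.

Lemma injective_hausdorff (X Y : topologicalType) (f : X -> Y) :
  continuous f -> injective f -> hausdorff_space Y -> hausdorff_space X.
Proof.
move=> cf injf hY x y xy; apply: injf; apply: hY => A B fxA fyB.
by have [z [Az Bz]] := xy _ _ (cf _ _ fxA) (cf _ _ fyB); exists (f z).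
Qed.

Lemma continuous_prod_topology (I : Type) (X : topologicalType)
    (K : I -> topologicalType) (f : X -> prod_topology K) :
  (forall i, continuous (fun x => f x i)) -> continuous f.
Proof.
move=> cf x; apply/cvg_sup => i.
by move: x; apply: continuous_comp_initial; exact: cf.
Qed.

Lemma compact_set_type (X : topologicalType) (A : set X) :
  compact A -> compact [set: set_type A].
Proof.
move=> cA F FF _.
have FA : \forall y \near F, A (set_val y).
  by apply: nearW => y; exact: set_valP.
have [x [Ax xF]] := cA _ (fmap_proper_filter set_val FF) FA.
exists (SigSub (mem_set Ax)); split=> // B C FB [_ [[W oW <-] Wx WC]].
have : (set_val @ F) (set_val @` B).
  by apply: (@filterS _ F _ B) FB; exact: preimage_image.
move=> /xF/(_ (open_nbhs_nbhs (conj oW Wx)))[_ [[y By <-] Wy]].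
by exists y; split=> //; exact: WC.
Qed.

Lemma image_closure (X Y : topologicalType) (f : X -> Y) (A : set X) :
  continuous f -> compact [set: X] -> hausdorff_space Y ->
  f @` closure A = closure (f @` A).
Proof.
move=> cf cX hY; apply/seteqP; split=> [_ [x Ax <-] B /cf /Ax[y [Ay By]]|].
  by exists (f y); split=> //; exists y.
have clA : closed (f @` closure A).
  apply: compact_closed hY _; apply: continuous_compact.
    exact: continuous_subspaceT.
  exact: subclosed_compact (@closed_closure _ A) cX (@subsetT _ _).
rewrite [X in _ `<=` X](closure_id _).1 //; apply: closureS.
exact/image_subset/subset_closure.
Qed.

Section cuts.
Variable R : realType.
Implicit Types (x y z : Gamma R) (p q : rat).

(* For p in [0, 1] this says that p^o <= x (see le_circ_cut); letting p range
   over all rationals spares range conditions on sums. *)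
Definition cut x p : bool := ratr p < gamma x ?<= if is_circ x.

Lemma le_circ_cut x z p :
  is_circ z -> gamma z = ratr p -> (z <= x)%O = cut x p.
Proof. by move=> zc zp; rewrite Gamma_leE zc zp /cut; case: (is_circ x). Qed.

Lemma le_minus_cut x z p :
  ~~ is_circ z -> gamma z = ratr p -> (x <= z)%O = ~~ cut x p.
Proof.
by move=> zm zp; rewrite Gamma_leE zm zp -lteifNE; case: (is_circ x).
Qed.

Lemma cut_le_gamma x p : cut x p -> ratr p <= gamma x.
Proof. exact: lteifW. Qed.

Lemma Ncut_gamma_le x p : ~~ cut x p -> gamma x <= ratr p.
Proof. by rewrite -lteifNE; exact: lteifW. Qed.

Lemma lt_gamma_cut x p : ratr p < gamma x -> cut x p.
Proof. exact: lteifS. Qed.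

Lemma gt_gamma_Ncut x p : gamma x < ratr p -> ~~ cut x p.
Proof. by rewrite -lteifNE; exact: lteifS. Qed.

Lemma cut_down x p q : p <= q -> cut x q -> cut x p.
Proof. by rewrite -(ler_rat R) => pq; exact: (@lteif_trans _ _ _ _ _ true). Qed.

Lemma cut_npos x p : p <= 0 -> cut x p.
Proof.
move=> p0; apply: cut_down p0 _; rewrite /cut rmorph0.
by have [_|/Gamma_minusP/andP[]//] := boolP (is_circ x); exact: gamma_ge0.
Qed.

Lemma cut_le1 x p : cut x p -> p <= 1.
Proof.
move=> /cut_le_gamma px; rewrite -(ler_rat R) rmorph1.
exact: le_trans px (gamma_le1 x).
Qed.

Lemma cut_separates x y : (y < x)%O -> exists2 p, cut x p & ~~ cut y p.
Proof.
rewrite Gamma_ltE; have [/rat_in_itvoo[p]|xy] := ltP (gamma y) (gamma x).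
  rewrite in_itv /= => /andP[yp px] _; exists p; first exact: lt_gamma_cut.
  exact: gt_gamma_Ncut.
case: ifP => // /andP[ym xc] yx; have [_ [p _ px]] := Gamma_circP xc.
exists p; first by rewrite -(le_circ_cut x xc).
by rewrite -(le_minus_cut _ ym) //; apply/eqP; rewrite eq_le px xy yx.
Qed.

Lemma le_cutP x y : (x <= y)%O <-> forall p, cut x p -> cut y p.
Proof.
split=> [xy p|xy]; last first.
  by rewrite leNgt; apply/negP => /cut_separates[p /xy ->].
move: xy; rewrite Gamma_leE /cut.
case: (is_circ x); case: (is_circ y) => //= xy px;
  [exact: le_trans px xy|exact: le_lt_trans px xy|
   exact/ltW/(lt_le_trans px xy)|exact: lt_le_trans px xy].
Qed.

Lemma cut_inj x y : cut x =1 cut y -> x = y.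
Proof.
move=> cut_xy; apply: le_anti; apply/andP.
by split; apply/le_cutP => p; rewrite cut_xy.
Qed.

Lemma cut_surj (C : set rat) :
  C 0 -> (forall p, C p -> p <= 1) -> (forall p q, p <= q -> C q -> C p) ->
  exists x, forall p, cut x p <-> C p.
Proof.
move=> C0 C1 Cdown; pose l : R := sup (ratr @` C).
have C_ub : has_ubound (@ratr R @` C).
  by exists 1 => _ [p /C1 p1 <-]; rewrite -(ler_rat R) rmorph1 in p1.
have C_le p : C p -> ratr p <= l by move=> Cp; apply: ub_le_sup => //; exists p.
have lt_C p : ratr p < l -> C p.
  move=> /(sup_gt (image_nonempty _ (ex_intro _ _ C0)))[_ [q Cq <-]].
  by rewrite ltr_rat => /ltW/Cdown; apply.
have l0 : 0 <= l by rewrite -(rmorph0 (@ratr R)); exact: C_le.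
have l1 : l <= 1.
  apply: ge_sup => [|_ [p /C1 + <-]]; first by exists (ratr 0), 0.
  by rewrite -(ler_rat R) rmorph1.
have [[q Cq ql]|Cl] := pselect (exists2 q, C q & ratr q = l).
  exists (circ l) => p; rewrite /cut is_circ_circ gamma_circ ?l0 //; last first.
    by rewrite -ql; exists q.
  split=> [|/C_le//] /=.
  by rewrite -ql ler_rat => /Cdown; apply.
have C_lt p : C p -> ratr p < l.
  move=> Cp; rewrite lt_neqAle C_le // andbT; apply/eqP => pl.
  by apply: Cl; exists p.
have l01 : 0 < l <= 1 by rewrite l1 -(rmorph0 (@ratr R)) C_lt.
exists (minus l) => p; rewrite /cut is_circ_minus // gamma_minus //.
by split=> [/lt_C|/C_lt].
Qed.

End cuts.

Section Gamma_topology.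
Variable R : realType.
Implicit Types (x y : Gamma R) (p : rat).

Lemma Gamma_subbasis_cut p : 0 < p <= 1 ->
  @Gamma_subbasis R [set x | cut x p] /\ @Gamma_subbasis R [set x | ~~ cut x p].
Proof.
rewrite -(ltr_rat R) -(ler_rat R) rmorph0 rmorph1 => p01.
have p_rational : rational (ratr p : R) by exists p.
have gamma_p : gamma (circ (ratr p : R)) = ratr p.
  by apply: gamma_circ => //; case/andP: p01 => /ltW ->.
split; [left; exists (circ (ratr p))|right; exists (minus (ratr p))].
- exact: is_circ_circ.
- by apply/funext => x; rewrite /= (le_circ_cut _ _ gamma_p) ?is_circ_circ.
- by rewrite is_circ_minus ?gamma_minus.
- apply/funext => x.
  by rewrite /= (le_minus_cut _ _ (gamma_minus p01)) ?is_circ_minus.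
Qed.

Lemma Gamma_subbasisP (B : set (Gamma R)) : Gamma_subbasis B ->
  exists p, B = [set x | cut x p] \/ B = [set x | ~~ cut x p].
Proof.
move=> [[z zc ->]|[z [zm [p _ /esym zp]] ->]].
  have [_ [p _ /esym zp]] := Gamma_circP zc; exists p; left.
  by apply/funext => x; rewrite /= (le_circ_cut _ zc zp).
by exists p; right; apply/funext => x; rewrite /= (le_minus_cut _ zm zp).
Qed.

Lemma cvg_cutP (F : set_system (Gamma R)) x : Filter F ->
  F --> x <-> forall p, \forall y \near F, cut y p = cut x p.
Proof.
move=> FF; rewrite (@cvg_subbase _ (@Gamma_subbasis R)) //.
split=> [Fx p|Fx B /Gamma_subbasisP[p [] ->] /= xp]; last 2 first.
- by apply: filterS (Fx p) => y; rewrite xp.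
- by apply: filterS (Fx p) => y /=; rewrite (negbTE xp) => ->.
have [p0|p0] := leP p 0; first by apply: nearW => y; rewrite !cut_npos.
have [p1|p1] := leP p 1; last first.
  by apply: nearW => y; apply/idP/idP => /cut_le1; rewrite leNgt p1.
have [|B_cut B_Ncut] := @Gamma_subbasis_cut p; first by rewrite p0.
have [xp|xp] := boolP (cut x p); first exact: Fx.
by apply: filterS (Fx _ B_Ncut xp) => y /negbTE.
Qed.

Lemma near_cut x p : \forall y \near x, cut y p = cut x p.
Proof. exact: (cvg_cutP x (nbhs_filter x)).1 cvg_id p. Qed.

Lemma compact_Gamma : compact [set: Gamma R].
Proof.
rewrite compact_ultra => F FU _; pose C : set rat := [set p | \near F, cut F p].
have [|p /filter_ex[y]|p q pq|x xC] := @cut_surj R C.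
- by apply: nearW => y; exact: cut_npos.
- exact: cut_le1.
- by apply: filterS => y; exact: cut_down.
exists x; split=> //; apply/cvg_cutP => p.
have [Cp|nCp] := in_ultra_setVsetC [set y | cut y p] FU.
  have /xC -> : C p by [].
  by apply: filterS Cp.
have /negbTE -> : ~~ cut x p.
  by apply/negP => /xC/(filterI nCp)/filter_ex[y []].
by apply: filterS nCp => y /negP/negbTE.
Qed.

Lemma gamma_continuous : continuous (@gamma R).
Proof.
move=> x; apply/(@cvgrPdist_lt _ _ _ _ (nbhs_filter x)) => e e0.
have [|p] := @rat_in_itvoo R (gamma x - e) (gamma x); first by lra.
have [|q] := @rat_in_itvoo R (gamma x) (gamma x + e); first by lra.
rewrite !in_itv /= => /andP[xq qx] /andP[xp px].
apply: filterS2 (near_cut x p) (near_cut x q) => y.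
rewrite (lt_gamma_cut px) (negbTE (gt_gamma_Ncut xq)).
move=> /cut_le_gamma py /negbT/Ncut_gamma_le yq.
by rewrite ltr_distlC; apply/andP; split; lra.
Qed.

End Gamma_topology.

Section cuts_of_differences.
Variable R : realType.
Implicit Types (x y z : Gamma R) (p q : rat).

Lemma cut_ominus_circ x z p q :
  (z <= x)%O -> is_circ z -> gamma z = ratr p ->
  cut (ominus x z) q = cut x (p + q).
Proof.
move=> zx zc zp; rewrite /cut gamma_ominus // is_circ_ominus // zc zp.
by rewrite lteifBrDl rmorphD.
Qed.

Lemma cut_ominus_minus x y q :
  (y <= x)%O -> ~~ is_circ y ->
  cut (ominus x y) q = (ratr q <= gamma x - gamma y).
Proof.
move=> yx /negbTE ym; rewrite /cut gamma_ominus // is_circ_ominus // ym.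
have [//|irr] := boolP (_ \in _); rewrite lteifF lt_neqAle andb_idl // => _.
by apply: contraNneq irr => <-; apply/mem_set; exists q.
Qed.

Lemma cut_ominusP x y q :
  (y <= x)%O -> cut (ominus x y) q <-> forall p, cut y p -> cut x (p + q).
Proof.
move=> yx; have [yc|ym] := boolP (is_circ y).
  have [_ [s _ /esym ys]] := Gamma_circP yc.
  rewrite (cut_ominus_circ _ yx yc ys); split=> [sq p|]; last first.
    by apply; rewrite -(le_circ_cut _ yc ys).
  rewrite {1}/cut yc ys lteifT ler_rat => ps; apply: cut_down sq.
  by rewrite lerD2r.
rewrite cut_ominus_minus //; split=> [qd p|xy].
  rewrite {1}/cut (negbTE ym) lteifF => py; apply: lt_gamma_cut.
  by rewrite rmorphD /=; lra.
rewrite leNgt; apply/negP => dq.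
have [|p] := @rat_in_itvoo R (gamma x - ratr q) (gamma y); first by lra.
rewrite in_itv /= => /andP[xp /lt_gamma_cut/xy/cut_le_gamma].
by rewrite rmorphD /=; lra.
Qed.

Lemma oslash_supremums x y : (y <= x)%O -> gamma y < gamma x ->
  supremums
    [set ominus x z | z in [set z | [/\ is_circ z, (y < z)%O & (z <= x)%O]]]
    (oslash x y).
Proof.
move=> yx ltyx.
have : gamma (Gamma_zero R) < gamma (oslash x y).
  by rewrite gamma_oslash // subr_gt0.
rewrite /oslash /supremum; case: ifP => _; first by rewrite ltxx.
by case: xgetP => [z _ //|_]; rewrite ltxx.
Qed.

Lemma circ_between_cuts x y p : ~~ cut y p -> cut x p ->
  exists z, [/\ is_circ z, gamma z = ratr p, (y < z)%O & (z <= x)%O].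
Proof.
move=> yp xp; have p01 : 0 <= (ratr p : R) <= 1.
  rewrite (le_trans (gamma_ge0 y) (Ncut_gamma_le yp)).
  exact: le_trans (cut_le_gamma xp) (gamma_le1 x).
have zc := is_circ_circ (ratr p : R).
have zp : gamma (circ (ratr p : R)) = ratr p.
  by apply: gamma_circ => //; exists p.
by exists (circ (ratr p)); rewrite ltNge !(le_circ_cut _ zc zp).
Qed.

(* The join defining oslash has q^o below it only if one of its members has,
   because q^o has q^- as an immediate predecessor. *)
Lemma cut_oslashP x y q : (y <= x)%O -> 0 < q ->
  cut (oslash x y) q <-> exists2 p, ~~ cut y p & cut x (p + q).
Proof.
move=> yx q0; have q0R : 0 < (ratr q : R) by rewrite ltr0q.
split=> [cut_q|[p yp xpq]]; last first.
  have ltyx : gamma y < gamma x.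
    have := cut_le_gamma xpq; have := Ncut_gamma_le yp.
    by rewrite rmorphD /=; lra.
  have xp : cut x p by apply: cut_down xpq; rewrite lerDl ltW.
  have [z [zc zp yz zx]] := circ_between_cuts yp xp.
  have [ub _] := oslash_supremums yx ltyx.
  have /le_cutP : (ominus x z <= oslash x y)%O by apply: ub; exists z.
  by apply; rewrite (cut_ominus_circ _ zx zc zp).
have qd : ratr q <= gamma x - gamma y by rewrite -gamma_oslash // cut_le_gamma.
have q01 : 0 < (ratr q : R) <= 1.
  by rewrite q0R -(rmorph1 (@ratr R)) ler_rat (cut_le1 cut_q).
have ltyx : gamma y < gamma x by lra.
have [_ lub] := oslash_supremums yx ltyx.
have le_minusE z : (z <= minus (ratr q))%O = ~~ cut z q.
  by rewrite (le_minus_cut _ _ (gamma_minus q01)) ?is_circ_minus.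
apply: contrapT => nxy; have : (oslash x y <= minus (ratr q))%O; last first.
  by rewrite le_minusE cut_q.
apply: lub => _ [z [zc yz zx] <-]; rewrite le_minusE.
have [_ [p _ /esym zp]] := Gamma_circP zc.
rewrite (cut_ominus_circ _ zx zc zp); apply/negP => xpq; apply: nxy.
by exists p; rewrite // -(le_circ_cut _ zc zp) -ltNge.
Qed.

Lemma oslash_le_ominusP x y x' y' : (y <= x)%O -> (y' <= x')%O ->
  (oslash x y <= ominus x' y')%O <->
  forall p p' q, 0 < q -> ~~ cut y p -> cut x (p + q) ->
    cut y' p' -> cut x' (p' + q).
Proof.
move=> yx yx'; split=> [/le_cutP le_xy p p' q q0 yp xp|xy].
  by apply: (cut_ominusP _ yx').1; apply/le_xy/cut_oslashP => //; exists p.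
apply/le_cutP => q; have [/cut_npos//|q0] := leP q 0.
move=> /(cut_oslashP yx q0)[p yp xp]; apply/cut_ominusP => // p'.
exact: xy yp xp.
Qed.

End cuts_of_differences.

Section spaces_of_measures.
Variables (R : realType) (d : Order.disp_t) (D : tbDistrLatticeType d).

Lemma closed_Gamma_measure : closed (Gamma_measure R D).
Proof.
move=> mu /= mu_closure.
have agree a p : \forall nu \near mu, cut (nu a) p = cut (mu a) p.
  exact: (@proj_continuous D (fun=> Gamma R) a mu _ (near_cut (mu a) p)).
have mu_le a b : (a <= b)%O -> (mu a <= mu b)%O.
  move=> ab; apply/le_cutP => p.
  have [nu [[_ _ nu_le _ _]]] := mu_closure _ (filterI (agree a p) (agree b p)).
  by move=> [<- <-]; apply: (le_cutP _ _).1; exact: nu_le.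
have mu_sub a b a' b' : (b <= a)%O -> (b' <= a')%O ->
    (forall nu, Gamma_measure R D nu ->
      oslash (nu a) (nu b) <= ominus (nu a') (nu b'))%O ->
    (oslash (mu a) (mu b) <= ominus (mu a') (mu b'))%O.
  move=> ba ba' nu_sub; apply/oslash_le_ominusP; [exact: mu_le|exact: mu_le|].
  move=> p p' q q0.
  have [nu [nuM]] := mu_closure _ (filterI
    (filterI (agree b p) (agree a (p + q)))
    (filterI (agree b' p') (agree a' (p' + q)))).
  move=> [[<- <-] [<- <-]]; have [_ _ nu_le _ _] := nuM.
  apply: (oslash_le_ominusP _ _).1 => //; [exact: nu_le..|exact: nu_sub].
have mu_const a x : (forall nu, Gamma_measure R D nu -> nu a = x) -> mu a = x.
  move=> nu_const; apply: cut_inj => p.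
  by have [nu [/nu_const <- ->]] := mu_closure _ (agree a p).
split.
- by apply: mu_const => nu [].
- by apply: mu_const => nu [].
- exact: mu_le.
- by move=> a b; apply: mu_sub; [exact: leIl|exact: leUr|move=> nu []].
- by move=> a b; apply: mu_sub; [exact: leUr|exact: leIl|move=> nu []].
Qed.

Lemma compact_M : compact [set: M R D].
Proof.
apply: compact_set_type.
apply: subclosed_compact closed_Gamma_measure _ (@subsetT _ _).
have := @tychonoff D (fun=> Gamma R) (fun=> setT) (fun=> @compact_Gamma R).
by congr compact; apply/seteqP.
Qed.

Lemma hausdorff_M_I : hausdorff_space (M_I R D).
Proof.
apply: (@injective_hausdorff _ _ (set_val : M_I R D -> {ptws D -> R})).
- exact: initial_continuous.
- exact: val_inj.
- by apply: hausdorff_product => ?; exact: Rhausdorff.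
Qed.

Lemma L_gamma_continuous : continuous (@L_gamma R d D).
Proof.
apply: continuous_comp_initial; apply: continuous_prod_topology => a mu.
apply: (@continuous_comp _ _ _ (fun nu : M R D => set_val nu a) (@gamma R)).
  apply: (@continuous_comp _ _ _ set_val (proj a : {ptws D -> Gamma R} -> _)).
    exact: initial_continuous.
  exact: proj_continuous.
exact: gamma_continuous.
Qed.

Lemma image_closure_L_gamma (U : set (M R D)) :
  @L_gamma R d D @` closure U = closure (@L_gamma R d D @` U).
Proof. exact: image_closure L_gamma_continuous compact_M hausdorff_M_I. Qed.

End spaces_of_measures.

Lemma L_gamma_stone_pairing (R : realType) (S : signature)
    (A : fin_structure S) :
  L_gamma (stone_pairing_Gamma R A) = stone_pairing_I R A.
Proof.
apply: val_inj; apply: funext => c; apply: gamma_circ.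
  by have [] := stone_pair_measure R A.
exact: stone_pair_rational.
Qed.

Theorem theorem3 (R : realType) (S : signature) :
  let U : set (M R (FO S)) :=
    [set mu | exists A : fin_structure S, mu = stone_pairing_Gamma R A] in
  let V : set (M_I R (FO S)) :=
    [set m | exists A : fin_structure S, m = stone_pairing_I R A] in
  @L_gamma R _ (FO S) @` closure U = closure V.
Proof.
move=> U V; rewrite image_closure_L_gamma; congr closure.
apply/seteqP; split=> [_ [_ [A ->] <-]|_ [A ->]].
  by exists A; exact: L_gamma_stone_pairing.
by exists (stone_pairing_Gamma R A); [exists A|exact: L_gamma_stone_pairing].
Qed.
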